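(* Let $k\ge1$ and let $w\in\{a^kb,a^{k+1}b\}^*\cup\{ab^k,ab^{k+1}\}^*$. Let $u$ be the derivative of $w$, i.e. $u=\varphi_k^{-1}(w)$ if $w\in\{a^kb,a^{k+1}b\}^*$ and $u=\hat\varphi_k^{-1}(w)$ if $w\in\{ab^k,ab^{k+1}\}^*$. If $u$ is a Christoffel word, then $w$ is a proper Christoffel word.
   Context: Alphabet $\{a,b\}$. The palindromization map $\psi$ is defined by $\psi(\varepsilon)=\varepsilon$ and $\psi(ux)=(\psi(u)x)^{(+)}$ for a word $u$ and letter $x$, where $z^{(+)}$ is the shortest palindrome having $z$ as prefix. A Christoffel word is either a letter $a$ or $b$ or a word $a\psi(v)b$ with $v\in\{a,b\}^*$; the latter are called proper. For $k\ge0$, $\varphi_k$ is the injective morphism $a\mapsto a^{k+1}b$, $b\mapsto a^kb$, and $\hat\varphi_k$ is the injective morphism $a\mapsto ab^k$, $b\mapsto ab^{k+1}$; $\varphi_k^{-1}(w)$ denotes the unique word $u$ with $\varphi_k(u)=w$ (similarly for $\hat\varphi_k$). *)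

(* Defs.v *)
From mathcomp Require Import all_boot.

Set Implicit Arguments.
Unset Strict Implicit.
Unset Printing Implicit Defensive.

(* The two-letter alphabet {a, b} is encoded by bool. *)
Definition letter : finType := bool.
Definition word := seq letter.
Definition la : letter := false.
Definition lb : letter := true.

Definition palindrome (w : word) : bool := rev w == w.

(* The existentially quantified tuple makes the search for a palindromic
   extension of a given length n decidable, so that [ex_minn] applies. *)
Definition has_pal_ext (z : word) (n : nat) : bool :=
  [exists t : n.-tuple letter, palindrome t && prefix z t].

Lemma ex_pal_ext (z : word) : exists n, has_pal_ext z n.
Proof.
exists (size (z ++ rev z)); apply/existsP; exists (in_tuple (z ++ rev z)).
by rewrite /palindrome /= rev_cat revK eqxx prefix_prefix.
Qed.

Lemma ex_shortest_pal_ext (z : word) :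
  exists t : (ex_minn (ex_pal_ext z)).-tuple letter,
    palindrome t && prefix z t.
Proof. by case: ex_minnP => n /existsP. Qed.

(* z^(+), the shortest palindrome having z as a prefix; see
   [pal_closureP] and [pal_closure_uniq]. *)
Definition pal_closure (z : word) : word := xchoose (ex_shortest_pal_ext z).

Definition shortest_pal_ext (z p : word) : Prop :=
  [/\ palindrome p, prefix z p &
      forall q : word, palindrome q -> prefix z q -> size p <= size q].

Lemma pal_closureP (z : word) : shortest_pal_ext z (pal_closure z).
Proof.
have /andP[pal_p pre_p] := xchooseP (ex_shortest_pal_ext z).
split=> // q pal_q pre_q; rewrite /pal_closure size_tuple.
case: ex_minnP => n _; apply; apply/existsP; exists (in_tuple q).
by rewrite pal_q.
Qed.

Lemma pal_closure_uniq (z p : word) :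
  shortest_pal_ext z p -> p = pal_closure z.
Proof.
case: (pal_closureP z); set c := pal_closure z.
move=> pal_c pre_c min_c [pal_p pre_p min_p].
have szE : size p = size c by apply/eqP; rewrite eqn_leq min_p ?min_c.
have szle : size p <= size z + size z.
  rewrite -{2}(size_rev z) -size_cat; apply: min_p; last exact: prefix_prefix.
  by rewrite /palindrome rev_cat revK.
have nthz (q : word) i : prefix z q -> i < size z -> nth la q i = nth la z i.
  by case/prefixP=> s -> lt_i; rewrite nth_cat lt_i.
apply: (@eq_from_nth _ la) => // i lt_i.
have [lt_iz | le_zi] := ltnP i (size z); first by rewrite !nthz.
have lt_jz : size p - i.+1 < size z.
  by rewrite ltn_subLR // addSn ltnS (leq_trans szle) // leq_add2r.
rewrite -(eqP pal_p) -(eqP pal_c) !nth_rev -?szE //.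
by rewrite !nthz.
Qed.

Definition psi (v : word) : word :=
  foldl (fun p x => pal_closure (rcons p x)) [::] v.

Definition proper_christoffel (w : word) : Prop :=
  exists v : word, w = la :: rcons (psi v) lb.

Definition christoffel (w : word) : Prop :=
  w = [:: la] \/ w = [:: lb] \/ proper_christoffel w.

Definition morphism (f : letter -> word) (u : word) : word :=
  flatten [seq f x | x <- u].

Definition phi (k : nat) : word -> word :=
  morphism (fun x => if x == la then rcons (nseq k.+1 la) lb
                     else rcons (nseq k la) lb).

Definition phihat (k : nat) : word -> word :=
  morphism (fun x => if x == la then la :: nseq k lb
                     else la :: nseq k.+1 lb).

Lemma phi_inj k : injective (phi k).
Proof.
have neq s t n : nseq n la ++ lb :: s <> nseq n.+1 la ++ lb :: t.
  by elim: n => [|n IH] //= [].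
have cut s t n : nseq n la ++ lb :: s = nseq n la ++ lb :: t -> s = t.
  by elim: n => [|n IH] /= [].
have phi_cons x u : phi k (x :: u) =
    nseq (if x == la then k.+1 else k) la ++ lb :: phi k u.
  by case: x; rewrite /phi /morphism /= ?cat_rcons.
have nilF x u : [::] <> phi k (x :: u).
  by rewrite phi_cons; case: (if _ then _ else _).
elim=> [|x u IH] [|y v] //; [by move/nilF | by move/esym/nilF |].
rewrite !phi_cons; case: x y => [] [] /=.
- by move/cut/IH->.
- by move/neq.
- by move/esym/neq.
- by case=> /cut/IH->.
Qed.

Lemma phihat_inj k : injective (phihat k).
Proof.
have headF u s : phihat k u <> lb :: s by case: u => [|[] u].
have cut s t n : nseq n lb ++ s = nseq n lb ++ t -> s = t.
  by elim: n => [|n IH] //= [].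
have snoc n : lb :: nseq n lb = nseq n lb ++ [:: lb].
  by elim: n => //= n {1}->.
have phihat_cons x u : phihat k (x :: u) =
    la :: nseq k lb ++ (if x == la then phihat k u else lb :: phihat k u).
  case: x; rewrite /phihat /morphism //=; congr (_ :: _).
  by rewrite -[lb :: _ ++ _]cat_cons snoc -catA.
elim=> [|x u IH] [|y v] //; rewrite ?phihat_cons // => -[/cut].
case: x y => [] [] /=.
- by case=> /IH->.
- by move/esym/headF.
- by move/headF.
- by move/IH->.
Qed.

(* X^*, the set of all finite concatenations of words of X. *)
Definition star (X : seq word) (w : word) : Prop :=
  exists2 s : seq word, {subset s <= X} & w = flatten s.

Definition phi_code (k : nat) : seq word :=
  [:: rcons (nseq k la) lb; rcons (nseq k.+1 la) lb].

Definition phihat_code (k : nat) : seq word :=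
  [:: la :: nseq k lb; la :: nseq k.+1 lb].

(* "u is the derivative of w" for the exponent k. By [phi_inj] and
   [phihat_inj], each disjunct determines u. For k = 1 both stars contain the
   powers of ab; for such w either inverse image counts as a derivative. *)
Definition derivative (k : nat) (w u : word) : Prop :=
  (star (phi_code k) w /\ phi k u = w) \/
  (star (phihat_code k) w /\ phihat k u = w).

(* Main.v *)
Require Import Defs.
From mathcomp Require Import all_boot.

(** The key is Justin's formula [psi (x v) = mu_x (psi v) x], where [mu_x] fixes
    [x] and sends the other letter [y] to [xy].  It follows from the description
    of [z^(+)] as [z ++ rev r], where [z = r ++ s] and [s] is the longest
    palindromic suffix of [z], because [mu_x (z) x] can only be cut in front of
    an [x] at a boundary of [mu_x]-blocks.  Iterating the formula expresses
    [psi (x^k y v)] through a morphism that is conjugate to [phi_k] (by [x^k y],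
    for [x = a]) and to [phihat_k] (by [x^k], for [x = b]).  Hence
    [phi_k (a psi(v) b) = a psi (a^k b v) b] and
    [phihat_k (a psi(v) b) = a psi (b^k a v) b]. *)

Set Implicit Arguments.
Unset Strict Implicit.
Unset Printing Implicit Defensive.

(** * Words and palindromic closure *)

Lemma rcons_nseq n (x : letter) : rcons (nseq n x) x = nseq n.+1 x.
Proof. by rewrite -addn1 nseqD cats1. Qed.

Lemma morphism_cat f u v : morphism f (u ++ v) = morphism f u ++ morphism f v.
Proof. by rewrite /morphism map_cat flatten_cat. Qed.

Lemma morphism_rcons f u y : morphism f (rcons u y) = morphism f u ++ f y.
Proof. by rewrite -cats1 morphism_cat /morphism /= cats0. Qed.

(** Suppose a palindrome [r ++ s ++ t] had [t] shorter than [r]. Read backwards, it begins with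
    [rev t], and removing [rev t] and [t] from its ends leaves a palindromic suffix of [r ++ s]
    longer than [s]. *)
Lemma pal_closure_lps (r s : word) :
    palindrome s ->
    (forall r' s' : word, r ++ s = r' ++ s' -> palindrome s' ->
       size r <= size r') ->
  pal_closure (r ++ s) = r ++ s ++ rev r.
Proof.
move=> pal_s min_r; apply/esym/pal_closure_uniq; split.
- by rewrite /palindrome !rev_cat revK (eqP pal_s) catA.
- by rewrite catA prefix_prefix.
move=> q pal_q /prefixP[t qE].
have [le_t|lt_t] := leqP (size r) (size t).
  by rewrite qE !size_cat size_rev addnA leq_add2l.
have eq_q : r ++ s ++ t = rev t ++ rev (r ++ s).
  by rewrite -rev_cat -qE (eqP pal_q) qE catA.
have le_t : size t <= size (r ++ s).
  by rewrite size_cat; apply: leq_trans (ltnW lt_t) (leq_addr _ _).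
have tE : rev t = take (size t) (r ++ s).
  have := congr1 (take (size t)) eq_q.
  by rewrite catA takel_cat // [RHS]take_size_cat ?size_rev.
have rsE := cat_take_drop (size t) (r ++ s); rewrite -tE in rsE.
suff /(min_r _ _ (esym rsE)) : palindrome (drop (size t) (r ++ s)).
  by rewrite size_rev leqNgt lt_t.
move: pal_q; rewrite qE; move: (drop _ _) rsE => d <-.
rewrite /palindrome !rev_cat revK -!catA.
by rewrite !eqseq_cat ?size_rev // => /and3P[].
Qed.

Lemma longest_pal_suffix (z : word) :
  exists r s : word, [/\ z = r ++ s, palindrome s &
    forall r' s' : word, z = r' ++ s' -> palindrome s' -> size r <= size r'].
Proof.
have ex_n : exists n, palindrome (drop n z).
  by exists (size z); rewrite drop_size.
case: (ex_minnP ex_n) => n pal_n min_n.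
exists (take n z), (drop n z); split=> [||r' s' zE pal_s'] //.
  by rewrite cat_take_drop.
apply: leq_trans (min_n (size r') _); first by rewrite size_take_min geq_minl.
by rewrite zE drop_size_cat.
Qed.

Lemma pal_closure_prefix (z z' : word) :
  prefix z z' -> prefix z' (pal_closure z) -> pal_closure z' = pal_closure z.
Proof.
move=> zz' z'c; apply/esym/pal_closure_uniq.
have [pal_c _ min_c] := pal_closureP z; split=> // q pal_q z'q.
exact: min_c pal_q (prefix_trans zz' z'q).
Qed.

Lemma pal_closure_pal (z : word) : palindrome z -> pal_closure z = z.
Proof.
move=> pal_z; rewrite -[in LHS](cat0s z) pal_closure_lps //= cats0 //.
Qed.

(** * The morphisms [mu x] and palindromic closure *)

Definition mu (x : letter) : word -> word :=
  morphism (fun y => if y == x then [:: x] else [:: x; y]).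

Lemma mu_cons x y u :
  mu x (y :: u) = if y == x then x :: mu x u else x :: y :: mu x u.
Proof. by rewrite /mu /morphism /=; case: ifP. Qed.

(** Every block starts with [x]; the [behead] form also covers the empty word. *)
Lemma mu_head x y u : y != x -> mu x u <> y :: behead (mu x u).
Proof.
case: u => [|z u] // nyx; rewrite mu_cons.
by case: ifP => _ [xy]; rewrite xy eqxx in nyx.
Qed.

Lemma mu_inj x : injective (mu x).
Proof.
elim=> [|y u IH] [|z v] //; rewrite ?mu_cons; try by case: ifP.
have [-> | nyx] := eqVneq y x; have [-> | nzx] := eqVneq z x => -[].
- by move/IH->.
- by move=> E; case: (@mu_head x z u nzx); rewrite E.
- by move=> E; case: (@mu_head x y v nyx); rewrite -E.
- by move=> -> /IH->.
Qed.

(** Reversal turns a block [xy] into [yx], and [(xy)x = x(yx)] shifts the extra [x] across it. *)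
Lemma mu_rev x u : mu x (rev u) ++ [:: x] = x :: rev (mu x u).
Proof.
elim: u => //= y u IH.
rewrite rev_cons {1}/mu morphism_rcons -/(mu x _) mu_cons.
have [_|_] := eqVneq y x.
  by rewrite rev_cons -cats1 -cat_cons -IH.
by rewrite !rev_cons -!cats1 -!cat_cons -IH -!catA.
Qed.

Lemma palindrome_mu x u : palindrome (mu x u ++ [:: x]) = palindrome u.
Proof.
rewrite /palindrome rev_cat /= -mu_rev eqseq_cat ?eqxx ?andbT.
  by rewrite (inj_eq (@mu_inj x)).
apply/eqP; rewrite -(eqn_add2r 1) -!(size_cat _ [:: x]) mu_rev.
by rewrite /= size_rev size_cat addn1.
Qed.

(** In each block [x] occurs only as the first letter. *)
Lemma mu_cut x z r s : mu x z ++ [:: x] = r ++ x :: s ->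
  exists r' s' : word,
    [/\ z = r' ++ s', r = mu x r' & x :: s = mu x s' ++ [:: x]].
Proof.
elim: z r => [|y z IH] r.
  by case: r => [[<-]|c [|//]] //; exists [::], [::].
case: r => [|c r]; first by move=> ?; exists [::], (y :: z).
rewrite mu_cons; have [-> | nyx] := eqVneq y x.
  case=> <- /IH[r' [s' [-> -> ->]]]; exists (x :: r'), s'.
  by rewrite mu_cons eqxx.
case: r => [|d r] [<-]; first by move=> yx; rewrite yx eqxx in nyx.
move=> <- /IH[r' [s' [-> -> ->]]]; exists (y :: r'), s'.
by rewrite mu_cons (negPf nyx).
Qed.

(** A nonempty palindromic suffix ends, hence begins, with [x]; by [mu_cut] it is [mu x s1 ++
    [:: x]] with [s1] a palindromic suffix of [z]. So longest palindromic suffixes correspond. *)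
Lemma pal_closure_mu x z :
  pal_closure (mu x z ++ [:: x]) = mu x (pal_closure z) ++ [:: x].
Proof.
have [r [s [zE pal_s min_r]]] := longest_pal_suffix z.
have -> : pal_closure z = r ++ s ++ rev r.
  by rewrite zE pal_closure_lps // -zE.
have zxE : mu x z ++ [:: x] = mu x r ++ mu x s ++ [:: x].
  by rewrite zE /mu morphism_cat catA.
rewrite zxE pal_closure_lps ?palindrome_mu // => [|r' s'].
  by rewrite {4}/mu !morphism_cat -!/(mu x _) -!catA mu_rev.
rewrite -zxE; case: (lastP s') => [|s0 c] E pal_s'.
  rewrite cats0 in E; rewrite -E zE /mu morphism_cat !size_cat.
  by rewrite -addnA leq_addr.
have cx : c = x.
  by have := congr1 (last x) E; rewrite !last_cat last_rcons.
rewrite {c}cx in E pal_s'.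
have s'E : rcons s0 x = x :: rev s0 by rewrite -(eqP pal_s') rev_rcons.
rewrite s'E in E; have [r1 [s1 [zE' -> s1E]]] := mu_cut E.
have /(min_r _ _ zE') le_r : palindrome s1 by rewrite -(palindrome_mu x) -s1E -s'E.
(* [mu x] does not preserve comparisons of length, but [r] and [r1] are both prefixes of [z], so [r]
   is a prefix of [r1]. *)
suff -> : r1 = r ++ drop (size r) r1 by rewrite /mu morphism_cat size_cat leq_addr.
rewrite -[LHS](cat_take_drop (size r)); congr (_ ++ _).
have := congr1 (take (size r)) zE'.
by rewrite zE take_size_cat // takel_cat.
Qed.

Lemma mu_no_double x y u r s : y != x -> mu x u = r ++ y :: s ->
  exists r0, r = rcons r0 x.
Proof.
move=> nyx; elim: u r => [|z u IH] r; first by case: r.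
rewrite mu_cons; case: r => [|c r].
  by case: ifP => _ [xy]; rewrite xy eqxx in nyx.
case: ifP => _ /= [<-].
  by case/IH=> r0 ->; exists (x :: r0).
case: r => [|d r]; first by exists [::].
by case=> <- /IH[r0 ->]; exists [:: x, z & r0].
Qed.

(** The longest palindromic suffix begins with [y], which is always preceded by [x]. Hence the
    closure appends [x] first, and adding this [x] beforehand changes nothing. *)
Lemma pal_closure_mu_rcons x y p : y != x ->
  pal_closure (mu x (rcons p y)) = pal_closure (mu x (rcons p y) ++ [:: x]).
Proof.
move=> nyx; apply/esym/pal_closure_prefix; first exact: prefix_prefix.
set t := mu x _.
have tE : t = rcons (mu x p ++ [:: x]) y.
  by rewrite /t /mu morphism_rcons (negPf nyx) -cats1 -catA.
have [r [s [rsE pal_s min_r]]] := longest_pal_suffix t.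
rewrite {2}rsE pal_closure_lps -?rsE // catA -rsE.
have [s1 sE] : exists s1, s = y :: s1.
  case: (lastP s) pal_s rsE => [_|s0 c /eqP pal_s] rsE.
    (* The one-letter palindrome [[:: y]] rules out an empty [s]. *)
    have := min_r (mu x p ++ [:: x]) [:: y].
    rewrite cats1 -tE => /(_ erefl (eqxx _)).
    by rewrite -[r]cats0 -rsE tE size_rcons ltnn.
  have yc : y = c by have := congr1 (last y) rsE; rewrite tE last_cat !last_rcons.
  by exists (rev s0); rewrite -pal_s rev_rcons yc.
have [r0 ->] : exists r0, r = rcons r0 x.
  by apply: (@mu_no_double x y (rcons p y) r s1); rewrite // -sE -rsE.
by rewrite rev_rcons -[x :: rev r0]cat1s [t ++ _ ++ _]catA prefix_prefix.
Qed.

(** * Justin's formula and its iterates *)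

Lemma psi_rcons v y : psi (rcons v y) = pal_closure (rcons (psi v) y).
Proof. by rewrite /psi -cats1 foldl_cat. Qed.

Lemma psi_cons x v : psi (x :: v) = mu x (psi v) ++ [:: x].
Proof.
elim/last_ind: v => [|v y IH].
  exact: (@pal_closure_pal [:: x] (eqxx _)).
rewrite -rcons_cons !psi_rcons IH -pal_closure_mu cats1.
(* For [y = x] both closures are of the same word; otherwise the words differ by a final [x], which
   the closure supplies anyway. *)
have [-> | nyx] := eqVneq y x.
  by rewrite -cats1 {2}/mu morphism_rcons eqxx -cats1.
rewrite -pal_closure_mu_rcons // /mu morphism_rcons (negPf nyx).
by rewrite -!cats1 -catA.
Qed.

(** The [k]-th iterate of [mu x] in closed form; see [mu_nu]. *)
Definition nu (k : nat) (x : letter) : word -> word :=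
  morphism (fun y => if y == x then [:: x] else rcons (nseq k x) y).

Lemma nu_cons k x y u :
  nu k x (y :: u) = (if y == x then [:: x] else rcons (nseq k x) y) ++ nu k x u.
Proof. by []. Qed.

Lemma mu_nseq x k : mu x (nseq k x) = nseq k x.
Proof. by elim: k => //= k IH; rewrite mu_cons eqxx IH. Qed.

Lemma mu_nu x k u : mu x (nu k x u) = nu k.+1 x u.
Proof.
elim: u => // y u IH; rewrite !nu_cons {1}/mu morphism_cat -!/(mu x _) IH.
congr (_ ++ _); have [_ | nyx] := eqVneq y x; first by rewrite mu_cons eqxx.
rewrite /mu morphism_rcons -/(mu x _) mu_nseq (negPf nyx) -cats1.
by rewrite -[[:: x; y]]/(nseq 1 x ++ [:: y]) catA -nseqD addn1.
Qed.

Lemma psi_nseq_cat k x v : psi (nseq k x ++ v) = nu k x (psi v) ++ nseq k x.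
Proof.
elim: k => [|k IH] /=.
  rewrite cats0 /nu /morphism.
  by elim: (psi v) => //= y u {1}->; case: eqP => [->|].
rewrite psi_cons IH {1}/mu morphism_cat -!/(mu x _) mu_nu mu_nseq -catA.
by rewrite -[[:: x]]/(nseq 1 x) -nseqD addn1.
Qed.

Lemma psi_nseq k x : psi (nseq k x) = nseq k x.
Proof. by rewrite -[in LHS](cats0 (nseq k x)) psi_nseq_cat. Qed.

Lemma psi_nseq_cons k x y v : y != x ->
  psi (nseq k x ++ y :: v) =
  nu k x (mu y (psi v)) ++ rcons (nseq k x) y ++ nseq k x.
Proof.
move=> nyx; rewrite psi_nseq_cat psi_cons {1}/nu morphism_cat -!/(nu k x _).
by rewrite nu_cons (negPf nyx) /= cats0 -catA.
Qed.

(** * Conjugation and images of Christoffel words *)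

Lemma phi_conj k u :
  rcons (nseq k la) lb ++ phi k u =
  nu k la (mu lb u) ++ rcons (nseq k la) lb.
Proof.
elim: u => [|y u IH]; first by rewrite cats0.
by rewrite mu_cons; case: y => /=; rewrite !nu_cons /= -!catA ?cat_cons -IH.
Qed.

Lemma phihat_conj k u :
  nseq k lb ++ phihat k u = nu k lb (mu la u) ++ nseq k lb.
Proof.
elim: u => [|y u IH]; first by rewrite cats0.
by rewrite mu_cons; case: y => /=;
  rewrite !nu_cons /= -!catA ?cat_cons -IH cat_rcons.
Qed.

(** The image is [a (a^k b phi_k(psi v)) a^k b]; [phi_conj] moves [a^k b] to the right of the
    bracket, giving [a^k b a^k b] at the end. *)
Lemma phi_proper k v :
  phi k (la :: rcons (psi v) lb) = la :: rcons (psi (nseq k la ++ lb :: v)) lb.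
Proof.
rewrite psi_nseq_cons // catA -phi_conj -[la :: rcons _ _]cat1s /phi.
by rewrite morphism_cat morphism_rcons /morphism /= cats0 -!cats1 /= -!catA.
Qed.

Lemma phihat_proper k v :
  phihat k (la :: rcons (psi v) lb) =
  la :: rcons (psi (nseq k lb ++ la :: v)) lb.
Proof.
rewrite psi_nseq_cons // -!cats1 -!catA.
rewrite [nu k lb _ ++ _]catA -phihat_conj -catA.
rewrite -[la :: psi v ++ _]cat1s /phihat !morphism_cat.
by rewrite /morphism /= !cats0 cats1 rcons_nseq.
Qed.

Theorem mainTheorem3 (k : nat) (w u : word) :
  1 <= k ->
  star (phi_code k) w \/ star (phihat_code k) w ->
  derivative k w u ->
  christoffel u ->
  proper_christoffel w.
Proof.
(* From here the exponent is [k.+1]. Its positivity makes [phi] of [b] start with [a] and [phihat]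
   of [a] end with [b], so single letters have proper images, with powers of one letter as directive
   words. *)
case: k => // k _ _ [[_ <-]|[_ <-]] [->|[->|[v ->]]].
- by exists (nseq k.+1 la); rewrite psi_nseq /phi /morphism /= cats0.
- by exists (nseq k la); rewrite psi_nseq /phi /morphism /= cats0.
- by eexists; apply: phi_proper.
- by exists (nseq k lb); rewrite psi_nseq /phihat /morphism /= cats0 rcons_nseq.
- by exists (nseq k.+1 lb); rewrite psi_nseq /phihat /morphism /= cats0 rcons_nseq.
- by eexists; apply: phihat_proper.
Qed.
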